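(* Let $G,\Omega,\Sigma=\{\Delta_1,\dots,\Delta_s\},\Delta=\Delta_1,L,M,R,\rho_{i,j},B_A$ be as in the context. Let $X:=G^{(2),\Omega}$ and $Y:=X_\Delta^\Delta$ (the permutation group induced on $\Delta$ by the setwise stabiliser $X_\Delta$). Suppose that $G\ne X$ but $L=L^{(2),\Sigma}$. (a) Then $X=N\rtimes G$ with $N=X\cap B_Y\ne1$, and $N$ is a subdirect subgroup of a base group $B_A=A^s$ for some $A\unlhd Y$. (b) If $M$ is maximal in $G$, then either (i) $N$ is a full diagonal subgroup of $B_A$; or (ii) for all distinct $i,j\le s$, $\rho_{i,j}(N)$ is not a full diagonal subgroup of $A\times A$; moreover, either $N$ contains the base group $B_{\mathcal S(Y)}$, or $Y$ has a unique minimal normal subgroup which is isomorphic to $C_p$, for some prime $p$. (c) Furthermore, if $M$ is maximal but not normal in $G$, and if in addition $p=|R|$ is prime and (b)(i) holds, then $Y=R$ and $N$ is the diagonal subgroup $\{(x,\dots,x): x\in R\}$ of $B_R=R^s\cong C_p^s$.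
   Context: For $P\le\mathrm{Sym}(\Gamma)$, $P^{(2),\Gamma}$ denotes the $2$-closure: all $g\in\mathrm{Sym}(\Gamma)$ leaving invariant each $P$-orbit on $\Gamma\times\Gamma$. If $P$ acts on $\Gamma$, $P^\Gamma$ is the induced permutation group. Setting. $G$ is a finite group acting faithfully, transitively and imprimitively on a finite set $\Omega$; $\Sigma=\{\Delta_1,\dots,\Delta_s\}$ is a nontrivial $G$-invariant partition of $\Omega$, $1<s<|\Omega|$; $L=G^\Sigma\le\mathrm{Sym}(\Sigma)$; $\Delta=\Delta_1$; $M=G_\Delta$ is the setwise stabiliser of $\Delta$; $R=M^\Delta\le\mathrm{Sym}(\Delta)$. It is assumed that $M$ is core-free in $G$ (equivalently $G$ acts faithfully on $\Sigma$, so $G\cong L$). By the imprimitive wreath embedding theorem, identify $\Sigma$ with $\{1,\dots,s\}$, $\Omega$ with $\Delta\times\{1,\dots,s\}$ and $\Delta_i$ with $\Delta\times\{i\}$ so that $G\le R\wr L=B_R\rtimes L$, where $B_R=R^s$, and $(x_1,\dots,x_s)\in B_R$ and $\sigma\in L$ act by $(\delta,i)^{(x_1,\dots,x_s)}=(\delta^{x_i},i)$ and $(\delta,i)^\sigma=(\delta,i^\sigma)$. For any $A\le\mathrm{Sym}(\Delta)$, $B_A=A^s$ denotes the naturally embedded base group in $\mathrm{Sym}(\Delta)\wr\mathrm{Sym}(s)$. On $B_A$, $\rho_{i,j}(x_1,\dots,x_s)=(x_i,x_j)$. A subgroup of a direct product is subdirect if it projects onto each direct factor. A full diagonal subgroup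 of $E^f$ is a subgroup of the form $\{(e,e^{\theta_2},\dots,e^{\theta_f}): e\in E\}$ with all $\theta_i\in\mathrm{Aut}(E)$. For a finite group $Y$, $\mathcal S(Y)$ is the intersection of all nontrivial subnormal subgroups of $Y$. *)

(* Defs.v *)
From HB Require Import structures.
From mathcomp Require Import all_boot all_order all_algebra.
From mathcomp Require Import all_fingroup all_solvable.

Set Implicit Arguments.
Unset Strict Implicit.
Unset Printing Implicit Defensive.

Import GroupScope.

Notation pts S := {x | x \in S}.

(* Permutations act on the right and [p * q] is "first p, then q".           *)

(* P^S, the subgroup of Sym(S) induced by P, for P a subgroup of the setwise
   stabiliser of S.  (The image of a morphism ignores elements outside its
   domain, which for [to^?] is the setwise stabiliser of S.)                 *)
Definition induced (aT : finGroupType) (T : finType) (to : {action aT &-> T})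
    (S : {set T}) (P : {set aT}) : {set {perm pts S}} :=
  actperm (subaction (pts S) to) @* P.

Canonical induced_group (aT : finGroupType) (T : finType)
    (to : {action aT &-> T}) (S : {set T}) (P : {group aT}) :=
  Eval hnf in [group of induced to S P].

(* ['P * 2] is the componentwise action on ordered pairs, so this is the group
   of all permutations leaving invariant each P-orbit on pairs.              *)
Definition closure2 (T : finType) (P : {set {perm T}}) : {set {perm T}} :=
  \bigcap_(t : 2.-tuple T) 'N(orbit ('P * 2) P t | 'P * 2).

Canonical closure2_group (T : finType) (P : {set {perm T}}) :=
  Eval hnf in [group of closure2 P].

(* The intersection of all nontrivial subnormal subgroups.                   *)
Definition subnormal_core (gT : finGroupType) (Y : {set gT}) : {set gT} :=
  \bigcap_(H : {group gT} | (H <|<| Y) && (H :!=: 1)) H.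

Definition minimal_normal (gT : finGroupType) (K Y : {set gT}) : bool :=
  [min K of H | (H :!=: 1) && (H <| Y)].

Section Wreath.

Variables D I : finType.

Definition base_fun (x : {ffun I -> {perm D}}) (u : D * I) : D * I :=
  (x u.2 u.1, u.2).

Lemma base_fun_inj x : injective (base_fun x).
Proof. by case=> [d i] [e j] [] /[swap] <- /perm_inj ->. Qed.

Definition base_perm x : {perm D * I} := perm (@base_fun_inj x).

Definition top_fun (sigma : {perm I}) (u : D * I) : D * I := (u.1, sigma u.2).

Lemma top_fun_inj sigma : injective (top_fun sigma).
Proof. by case=> [d i] [e j] [] -> /perm_inj ->. Qed.

Definition top_perm sigma : {perm D * I} := perm (@top_fun_inj sigma).

Definition base_group (A : {set {perm D}}) : {set {perm D * I}} :=
  [set base_perm x | x : {ffun I -> {perm D}} in ffun_on [in A]].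

Definition wreath (A : {set {perm D}}) (L : {set {perm I}}) :
    {set {perm D * I}} :=
  base_group A * (top_perm @: L).

Section Identification.

(* [phi] is meant to be a bijection, identifying Omega with D * I.           *)
Variables (Omega : finType) (phi : Omega -> D * I).

Definition same_perm (g : {perm Omega}) (w : {perm D * I}) : bool :=
  [forall o, phi (g o) == w (phi o)].

(* W, viewed inside Sym(Omega).                                              *)
Definition transport (W : {set {perm D * I}}) : {set {perm Omega}} :=
  [set g | [exists w in W, same_perm g w]].

(* N, viewed as a set of tuples; meant for N contained in the base group.    *)
Definition tuples (N : {set {perm Omega}}) : {set {ffun I -> {perm D}}} :=
  [set x | [exists g in N, same_perm g (base_perm x)]].

End Identification.

End Wreath.

Section Tuples.

Variables (I : finType) (gT : finGroupType).
Implicit Types (E : {set gT}) (N : {set {ffun I -> gT}}).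

Definition subdirect E N : Prop :=
  N \subset ffun_on [in E] /\
  (forall i, [set x i | x : {ffun I -> gT} in N] = E).

(* The coordinate [i1] plays the role of the first one.                      *)
Definition full_diagonal (i1 : I) E N : Prop :=
  exists theta : I -> {perm gT},
    [/\ forall i, theta i \in Aut E,
        theta i1 = 1
      & N = [set [ffun i => theta i e] | e in E]].

Definition full_diagonal2 E (P : {set gT * gT}) : Prop :=
  exists2 theta : {perm gT}, theta \in Aut E & P = [set (e, theta e) | e in E].

Definition rho (i j : I) (x : {ffun I -> gT}) : gT * gT := (x i, x j).

Definition straight_diagonal E : {set {ffun I -> gT}} :=
  [set [ffun=> e] | e in E].

End Tuples.

Arguments straight_diagonal : clear implicits.

(* Main.v *)
From HB Require Import structures.
Require Import Defs.
From mathcomp Require Import all_boot all_order all_algebra.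
From mathcomp Require Import all_fingroup all_solvable.
From mathcomp Require Import mxabelem.

(* Let [K] be the kernel of [X] on [Sigma].  The group [X] induces on [Sigma]
   a subgroup of the 2-closure of [L], which is [L], so [X = K * G]; and
   [K :&: G] lies in the core of [M].  Read through [phi], [K] is a subgroup of
   the base group on which conjugation by [G] permutes the coordinates, up to
   conjugation by elements of [R]; hence [K] is subdirect in [A^s], where [A] is
   the group that [K] induces on [Delta].
   The kernel of the coordinate of a block [B] is ['C_K(B | 'P)], a
   G-equivariant function of [B].  If [M] is maximal, then [G] is primitive on
   [Sigma], so this function is constant or injective.  If it is constant, then
   one coordinate determines all the others.  If it is injective, then each
   kernel has nontrivial normal image in all the other coordinates; when [S(Y)]
   is perfect, commutators of elements of different kernels then show that [K]
   contains [S(Y)^s], and otherwise [S(Y)] is simple of prime order.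
   For (c), [R] is abelian and transitive, hence 2-closed, whence [Y = R = A];
   as [Y] is abelian, [~: M, K] fixes [Delta] pointwise, so it is trivial when
   [K] is a full diagonal.  The normal subgroup ['C_G(K)] then contains [M]
   properly, so it is [G], and [G] permutes the coordinates transitively. *)

Set Implicit Arguments.
Unset Strict Implicit.
Unset Printing Implicit Defensive.

Import GroupScope.

Lemma normal_sup_nonnormal_maximal (gT : finGroupType) (G M H : {group gT}) :
  maximal M G -> ~~ (M <| G) -> M \subset H -> H <| G -> H :=: G.
Proof.
case/maxgroupP=> _ maxM not_nsMG sMH nsHG; apply: contraNeq not_nsMG => neqHG.
have <-: H :=: M by apply: maxM; rewrite // properEneq neqHG normal_sub.
exact: nsHG.
Qed.

Lemma perfect_sub_morphimI (aT rT : finGroupType) (D : {group aT})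
    (f : {morphism D >-> rT}) (H K : {group aT}) (T : {group rT}) :
    [~: T, T] = T -> H \subset D -> K \subset D ->
    H \subset 'N(K) -> K \subset 'N(H) ->
  T \subset f @* H -> T \subset f @* K -> T \subset f @* (H :&: K).
Proof.
move=> perfT sHD sKD nKH nHK sTH sTK; rewrite -perfT.
apply: subset_trans (commgSS sTH sTK) _; rewrite -morphimR // morphimS //.
by rewrite subsetI commg_subl nHK commg_subr nKH.
Qed.

Lemma perfect_sub_morphim_bigcap (aT rT : finGroupType) (D N : {group aT})
    (f : {morphism D >-> rT}) (T : {group rT}) (I : finType) (P : pred I)
    (K : I -> {group aT}) :
    [~: T, T] = T -> N \subset D -> (forall i, P i -> K i <| N) ->
    T \subset f @* N -> (forall i, P i -> T \subset f @* K i) ->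
  T \subset f @* (N :&: \bigcap_(i | P i) K i).
Proof.
move=> perfT sND nsKN sTN sTK.
suff [H [-> _ sTH]] : exists H : {group aT},
    [/\ N :&: \bigcap_(i | P i) K i = H, H <| N & T \subset f @* H] by [].
elim/big_rec: _ => [|i Q Pi [H [defH nsHN sTH]]].
  by exists N; rewrite setIT normal_refl.
exists (K i :&: H)%G; rewrite /= -defH setICA.
have [[sKN nKN] [sHN nHN]] := (andP (nsKN i Pi), andP nsHN).
split=> //; first by rewrite defH normalI ?nsKN.
rewrite defH; apply: perfect_sub_morphimI (sTK i Pi) sTH => //.
- exact: subset_trans sKN sND.
- exact: subset_trans sHN sND.
- exact: subset_trans sKN nHN.
exact: subset_trans sHN nKN.
Qed.

Lemma prim_equivariant_const_or_inj (aT : finGroupType) (sT rT : finType)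
    (G : {group aT}) (to : {action aT &-> sT}) (to' : {action aT &-> rT})
    (S : {set sT}) (f : sT -> rT) :
    [primitive G, on S | to] ->
    {in S & G, forall x a, f (to x a) = to' (f x) a} ->
  {in S &, forall x y, f x = f y} \/ {in S &, injective f}.
Proof.
move=> primG f_equiv; have [trG _] := andP primG; have [x Sx _] := imsetP trG.
have from_x := atransP2 trG Sx.
have sCxCfx : 'C_G[x | to] \subset 'C_G[f x | to'].
  apply/subsetP=> a /setIP[Ga /astab1P xa].
  by rewrite inE Ga; apply/astab1P; rewrite -f_equiv // xa.
move: primG; rewrite (trans_prim_astab Sx) // => /maximal_eqP[_ maxCx].
have [CfxE | CfxE] := maxCx 'C_G[f x | to']%G sCxCfx (subsetIl _ _).
- right=> y z /from_x[a Ga ->] /from_x[b Gb ->].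
  rewrite !f_equiv // => /(canLR (actK _ _)); rewrite -actM => /astab1P Cab.
  have: a * b^-1 \in 'C_G[x | to] by rewrite -CfxE inE Cab groupM ?groupV.
  by case/setIP=> _ /astab1P; rewrite actM => /(canRL (actKV _ _)).
- have fix_fx a : a \in G -> to' (f x) a = f x.
    by rewrite -CfxE => /setIP[_ /astab1P].
  by left=> y z /from_x[a Ga ->] /from_x[b Gb ->]; rewrite !f_equiv // !fix_fx.
Qed.

Section Blocks.

Variables (aT : finGroupType) (sT : finType) (to : {action aT &-> sT}).
Variables (G : {group aT}) (S : {set sT}) (P : {set {set sT}}).
Hypotheses (partP : partition P S) (actsGP : [acts G, on P | to^*]).

Lemma setact_block B C a x : a \in G -> B \in P -> C \in P ->
  x \in B -> to x a \in C -> to^* B a = C.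
Proof.
move=> Ga PB PC Bx Cxa; have [_ tiP _] := and3P partP.
rewrite -(def_pblock tiP PC Cxa); apply/esym/def_pblock => //.
  by rewrite (actsP actsGP).
exact: mem_setact.
Qed.

Lemma block_nonempty B : B \in P -> exists x, x \in B.
Proof.
have [_ _ ntP] := and3P partP; move=> PB.
by apply/set0Pn; apply: contraNneq ntP => <-.
Qed.

Lemma atrans_blocks : [transitive G, on S | to] -> [transitive G, on P | to^*].
Proof.
move=> trG; have [x Sx _] := imsetP trG; have [/eqP defS _ _] := and3P partP.
move: Sx; rewrite -defS => /bigcupP[B PB Bx].
apply/imsetP; exists B => //; apply/setP=> C.
apply/idP/orbitP=> [PC | [a Ga <-]]; last by rewrite (actsP actsGP).
have [y Cy] := block_nonempty PC.
have [Sx Sy] : x \in S /\ y \in S.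
  by rewrite -defS; split; apply/bigcupP; [exists B | exists C].
have [a Ga def_y] := atransP2 trG Sx Sy; rewrite def_y in Cy.
by exists a => //; apply: setact_block Cy.
Qed.

Lemma atrans_astabs_block B : [transitive G, on S | to] -> B \in P ->
  [transitive 'N_G(B | to), on B | to].
Proof.
move=> trG PB; have [x Bx] := block_nonempty PB.
have sBS : B \subset S by rewrite -(cover_partition partP) (bigcup_sup B).
apply/imsetP; exists x => //; apply/setP=> y; apply/idP/orbitP=> [By | [a]].
  have [a Ga def_y] := atransP2 trG (subsetP sBS x Bx) (subsetP sBS y By).
  exists a => //; rewrite inE Ga /= -astab1_set; apply/astab1P.
  by apply: (setact_block Ga PB PB Bx); rewrite -def_y.
by case/setIP=> _ nBa <-; rewrite (astabs_act _ nBa).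
Qed.

End Blocks.

Section Induced.

Variables (aT : finGroupType) (T : finType) (to : {action aT &-> T}).
Variable S : {set T}.

Lemma subact_dom_pts : subact_dom (fun x => x \in S) to = 'N(S | to).
Proof. by congr 'N(_ | _); apply/setP=> x; rewrite inE. Qed.

Definition restrict : aT -> {perm pts S} := actperm (subaction (pts S) to).

Fact restrictM : {in 'N(S | to) &, {morph restrict : a b / a * b}}.
Proof. by rewrite -subact_dom_pts; apply: actpermM. Qed.

Canonical restrict_morphism := Morphism restrictM.

Lemma inducedE (P : {set aT}) : induced to S P = restrict @* P.
Proof. by congr (_ @: (_ :&: _)); apply: subact_dom_pts. Qed.

Lemma val_restrict a (u : pts S) :
  a \in 'N(S | to) -> val (restrict a u) = to (val u) a.
Proof. by move=> nSa; rewrite actpermE val_subact subact_dom_pts nSa. Qed.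

Lemma ker_restrict : 'ker restrict = 'C(S | to).
Proof.
apply/setP=> a; apply/idP/idP=> [/morphpreP[nSa /set1P ra1] | cSa].
  by apply/astabP=> x Sx; rewrite -(val_restrict (exist _ x Sx) nSa) ra1 perm1.
have nSa := subsetP (astab_sub to S) a cSa.
apply/kerP=> //; apply/permP=> u; apply: val_inj.
by rewrite val_restrict // perm1 (astab_act cSa) ?(valP u).
Qed.

Lemma inducedP (P : {set aT}) y :
  reflect (exists2 a, a \in P :&: 'N(S | to) & y = restrict a)
          (y \in induced to S P).
Proof. by rewrite inducedE /morphim setIC; apply: imsetP. Qed.

Lemma der1_sub_astab (P : {group aT}) : P \subset 'N(S | to) ->
  abelian (induced to S P) -> [~: P, P] \subset 'C(S | to).
Proof.
move=> nSP /commG1P; rewrite inducedE -morphimR // -ker_restrict => PP1.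
by rewrite ker_trivg_morphim PP1 (subset_trans (der_sub 1 P)) /=.
Qed.

Lemma induced_transitive (P : {group aT}) : [transitive P, on S | to] ->
  [transitive induced to S P, on [set: pts S] | 'P].
Proof.
move=> trP; have [x Sx _] := imsetP trP.
apply/imsetP; exists (exist _ x Sx) => //; apply/esym/setP=> y; rewrite inE.
have [a Pa xa] := atransP2 trP Sx (valP y); apply/orbitP.
have nSa : a \in 'N(S | to) by rewrite (subsetP (atrans_acts trP)).
exists (restrict a); last by apply: val_inj; rewrite /= /aperm val_restrict.
by apply/inducedP; exists a; rewrite // inE Pa.
Qed.

End Induced.

Section Closure2.

Variable T : finType.
Implicit Type G : {group {perm T}}.

Lemma closure2P G (x : {perm T}) :
  reflect (forall a b, exists2 g, g \in G & g a = x a /\ g b = x b)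
          (x \in closure2 G).
Proof.
apply: (iffP bigcapP) => [Xx a b | Gx t _].
  have:= astabs_act [tuple a; b] (Xx [tuple a; b] isT).
  rewrite orbit_refl => /orbitP[g Gg] /(congr1 val) [ga gb].
  by exists g.
rewrite !inE; apply/subsetP=> u tGu; rewrite inE -(orbit_eqP tGu).
have [g Gg [ga gb]] := Gx (tnth u ord0) (tnth u ord_max).
apply/orbitP; exists g => //; apply: eq_from_tnth => i; rewrite !tnth_map /=.
case: (unliftP ord0 i) => [j|] -> //.
by rewrite (_ : lift _ _ = ord_max) //; apply: val_inj; rewrite (ord1 j).
Qed.

Lemma sub_closure2 G : G \subset closure2 G.
Proof. by apply/subsetP=> g Gg; apply/closure2P => a b; exists g. Qed.

Lemma closure2_abelian_transitive G :
  abelian G -> [transitive G, on [set: T] | 'P] -> closure2 G = G.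
Proof.
move=> cGG trG; apply/eqP; rewrite eqEsubset sub_closure2 andbT.
have [a _ _] := imsetP trG.
apply/subsetP=> x /closure2P Xx; have [g Gg [ga _]] := Xx a a.
rewrite (_ : x = g) //; apply/permP=> b; have [h Gh [ha <-]] := Xx a b.
have [k Gk ->] := atransP2 trG (in_setT a) (in_setT b).
rewrite /= /aperm -!permM.
by rewrite (centsP cGG _ Gk _ Gh) (centsP cGG _ Gk _ Gg) !permM ha ga.
Qed.

End Closure2.

Section Closure2Blocks.

Variables (T : finType) (G : {group {perm T}}).
Variables (S : {set T}) (P : {set {set T}}).
Hypotheses (partP : partition P S) (actsGP : [acts G, on P | 'P^*]).

Lemma closure2_setact_block x g B o : x \in closure2 G -> g \in G -> B \in P ->
  o \in B -> g o = x o -> 'P^*%act B x = 'P^*%act B g.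
Proof.
move=> /closure2P Xx Gg PB Bo go; apply/eqP.
rewrite eqEcard !card_setact leqnn andbT; apply/subsetP=> _ /imsetP[o' Bo' ->].
have [h Gh [ho ho']] := Xx o o'.
have PBg : 'P^*%act B g \in P by rewrite (actsP actsGP).
have <-: 'P^*%act B h = 'P^*%act B g.
  apply: (setact_block partP actsGP Gh PB PBg Bo).
  by rewrite /= /aperm ho -go; apply: (mem_setact 'P g Bo).
by rewrite /= /aperm -ho'; apply: (mem_setact 'P h Bo').
Qed.

Lemma closure2_acts_blocks : [acts closure2 G, on P | 'P^*].
Proof.
apply/subsetP=> x Xx; rewrite !inE; apply/subsetP=> B PB; rewrite inE.
have [o Bo] := block_nonempty partP PB.
have [g Gg [go _]] := closure2P _ _ Xx o o.
by rewrite (closure2_setact_block Xx Gg PB Bo go) (actsP actsGP).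
Qed.

Lemma induced_blocks_closure2 :
  induced 'P^* P (closure2 G) \subset closure2 (induced 'P^* P G).
Proof.
apply/subsetP=> _ /inducedP[x /setIP[Xx nPx] ->]; apply/closure2P=> B C.
have [o Bo] := block_nonempty partP (valP B).
have [o' Co'] := block_nonempty partP (valP C).
have [g Gg [go go']] := closure2P _ _ Xx o o'.
have nPg := subsetP actsGP g Gg; exists (restrict 'P^* P g).
  by apply/inducedP; exists g; rewrite // inE Gg.
split; apply: val_inj; rewrite !val_restrict //.
  exact/esym/(closure2_setact_block Xx Gg (valP B) Bo go).
exact/esym/(closure2_setact_block Xx Gg (valP C) Co' go').
Qed.

Lemma induced_block_closure2 B : B \in P ->
  induced 'P B 'N_(closure2 G)(B | 'P) \subset
    closure2 (induced 'P B 'N_G(B | 'P)).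
Proof.
move=> PB; apply/subsetP=> _ /inducedP[x /setIP[/setIP[Xx nBx] _] ->].
apply/closure2P=> a b; have [g Gg [ga gb]] := closure2P _ _ Xx (val a) (val b).
have nBg : g \in 'N(B | 'P).
  rewrite -astab1_set; apply/astab1P.
  rewrite -(closure2_setact_block Xx Gg PB (valP a) ga).
  by apply/astab1P; rewrite astab1_set.
exists (restrict 'P B g).
  by apply/inducedP; exists g; rewrite // -setIA setIid inE Gg.
by split; apply: val_inj; rewrite !val_restrict.
Qed.

Lemma closure2_sdprod B : B \in P ->
    closure2 (induced 'P^* P G) = induced 'P^* P G ->
    gcore 'N_G(B | 'P) G = 1 ->
  'C_(closure2 G)(P | 'P^*) ><| G = closure2 G.
Proof.
move=> PB closedGP coreGB; have sGX := sub_closure2 G.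
have actsXP := closure2_acts_blocks.
have nKX : closure2 G \subset 'N('C_(closure2 G)(P | 'P^*)).
  by rewrite normsI ?normG // (subset_trans actsXP) ?astab_norm.
have tiKG : 'C_(closure2 G)(P | 'P^*) :&: G = 1.
  apply/trivgP; rewrite -coreGB; apply: gcore_max.
    rewrite /= setIC setIS // -astab1_set subIset //.
    by rewrite orbC astabS // sub1set.
  by rewrite normsI ?normG ?(subset_trans sGX).
rewrite sdprodE ?(subset_trans sGX) //= group_modr //; apply/setIidPl.
rewrite -(ker_restrict 'P^* P) -morphimK ?(subset_trans sGX) //.
by rewrite -sub_morphim_pre // -!inducedE -closedGP induced_blocks_closure2.
Qed.

End Closure2Blocks.

Section SubnormalCore.

Variables (gT : finGroupType) (Y : {group gT}).

Canonical subnormal_core_group := Eval hnf in [group of subnormal_core Y].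

Lemma subnormal_core_min (H : {group gT}) :
  H <|<| Y -> H :!=: 1 -> subnormal_core Y \subset H.
Proof. by move=> snHY ntH; apply: bigcap_inf; rewrite snHY. Qed.

Hypothesis ntY : Y :!=: 1.

Lemma subnormal_core_normal : subnormal_core Y <| Y.
Proof.
rewrite /normal subnormal_core_min ?subnormal_refl //=.
apply/subsetP=> y Yy; rewrite inE.
apply/bigcapsP=> H /andP[snHY ntH]; rewrite sub_conjg.
apply: subnormal_core_min; last first.
  by rewrite -(inj_eq (@conjsg_inj _ y)) conjsgKV conjs1g.
have := morphim_subnormal (conjgm_morphism Y y^-1) snHY.
rewrite !morphim_conj setIid (setIidPr (subnormal_sub snHY)).
by rewrite (conjGid (groupVr Yy)).
Qed.

Lemma subnormal_core_simple :
  subnormal_core Y :!=: 1 -> simple (subnormal_core Y).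
Proof.
move=> ntT; apply/simpleP; split=> // H nsHT.
have [-> | ntH] := eqVneq (H : {set gT}) 1; [by left | right].
apply/eqP; rewrite eqEsubset normal_sub //=; apply: subnormal_core_min => //.
apply: subnormal_trans (normal_subnormal nsHT) _.
exact: normal_subnormal subnormal_core_normal.
Qed.

Lemma minimal_normal_subnormal_core :
  subnormal_core Y :!=: 1 -> minimal_normal (subnormal_core Y) Y.
Proof.
move=> ntT; apply/mingroupP; rewrite ntT subnormal_core_normal; split=> // H.
case/andP=> ntH nsHY sHT; apply/eqP; rewrite eqEsubset sHT.
exact: subnormal_core_min (normal_subnormal nsHY) ntH.
Qed.

Lemma minimal_normal_eq_subnormal_core (H : {group gT}) :
  subnormal_core Y :!=: 1 -> minimal_normal H Y -> H :=: subnormal_core Y.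
Proof.
move=> ntT /mingroupP[/andP[ntH nsHY] minH].
apply/esym/(minH subnormal_core_group).
  by rewrite ntT subnormal_core_normal.
exact: subnormal_core_min (normal_subnormal nsHY) ntH.
Qed.

Lemma subnormal_core_perfect_or_prime :
  [~: subnormal_core Y, subnormal_core Y] = subnormal_core Y \/
  prime #|subnormal_core Y|.
Proof.
have [T1 | ntT] := eqVneq (subnormal_core Y) 1.
  by left; rewrite T1 commG1.
have simT := subnormal_core_simple ntT; have [_ minT] := simpleP _ simT.
case: (minT _ (der_normal 1 _)) => [/commG1P cTT|]; last by left.
by right; apply: simple_sol_prime (abelian_sol cTT) simT.
Qed.

End SubnormalCore.

(* The library makes a [finGroupType] of [{dffun _}] only. *)
HB.instance Definition _ (I : finType) (gT : finGroupType) :=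
  Group.on {ffun I -> gT}.

Section DirectPower.

Variables (I : finType) (gT : finGroupType).
Implicit Types (A : {group gT}) (N : {group {ffun I -> gT}}).
Implicit Type x : {ffun I -> gT}.

Definition coord (i : I) x : gT := x i.

Fact coordM i : {morph coord i : x y / x * y}.
Proof. by move=> x y; rewrite /coord ffunE. Qed.

Canonical coord_morphism i := @Morphism _ _ setT (coord i) (in2W (coordM i)).

Lemma mem_im_coord N i x : x \in N -> x i \in coord i @* N.
Proof. by move=> Nx; rewrite -[x i]/(coord i x) mem_morphim ?inE. Qed.

Definition power (A : {set gT}) : {set {ffun I -> gT}} :=
  [set x in ffun_on [in A]].

Lemma powerP (A : {set gT}) x : reflect (forall i, x i \in A) (x \in power A).
Proof. by rewrite inE; apply: ffun_onP. Qed.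

Fact power_group_set A : group_set (power A).
Proof.
apply/group_setP; split=> [|x y /powerP Ax /powerP Ay]; apply/powerP=> i.
  by rewrite ffunE group1.
by rewrite ffunE groupM ?Ax ?Ay.
Qed.

Canonical power_group A := group (power_group_set A).

Lemma card_power (A : {set gT}) : #|power A| = (#|A| ^ #|I|)%N.
Proof. by rewrite cardsE card_ffun_on. Qed.

Lemma abelem_power p A : prime p -> p.-abelem A -> p.-abelem (power A).
Proof.
move=> p_pr /(abelemP p_pr)[cAA expA]; apply/(abelemP p_pr).
split=> [|x /powerP Ax]; last first.
  apply/ffunP=> i; rewrite -[LHS]/(coord i _) morphX ?inE // ffunE.
  exact: expA (Ax i).
apply/centsP=> x /powerP Ax y /powerP Ay; apply/ffunP=> i; rewrite !ffunE.
exact: (centsP cAA).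
Qed.

Lemma subdirectP (A : {set gT}) N :
  subdirect A N <-> forall i, coord i @* N = A.
Proof.
have coordE i : coord i @* N = [set x i | x : {ffun I -> gT} in N].
  by rewrite morphimEsub ?subsetT.
split=> [[_ defA] i | defA]; first by rewrite coordE.
split=> [|i]; last by rewrite -coordE.
by apply/subsetP=> x Nx; apply/ffun_onP=> i; rewrite -(defA i) mem_im_coord.
Qed.

Lemma power_isog_Fp p A : prime p -> #|A| = p ->
  power A \isog [set: 'rV['F_p]_#|I|].
Proof.
move=> p_pr oA; have abA : p.-abelem A by rewrite -oA prime_abelem ?oA.
rewrite (isog_abelem_card _ (abelem_power p_pr abA)) mx_Fp_abelem //=.
by rewrite card_power oA cardsT card_mx card_Fp // mul1n.
Qed.

Lemma straight_diagonal_const (i1 : I) A N : coord i1 @* N = A ->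
    (forall x i, x \in N -> x i = x i1) ->
  N :=: straight_diagonal I gT A.
Proof.
move=> <- Nconst; have constE x : x \in N -> [ffun=> x i1] = x.
  by move=> Nx; apply/ffunP=> i; rewrite ffunE Nconst.
apply/setP=> x; apply/idP/imsetP=> [Nx | [_ /morphimP[y _ Ny ->] ->]].
  by exists (x i1); rewrite ?mem_im_coord ?constE.
by rewrite [finfun _]constE.
Qed.

Lemma mem_ker_coord N i x :
  (x \in 'ker_N (coord i)) = (x \in N) && (x i == 1).
Proof. by rewrite !inE. Qed.

Lemma ker_coord_normal N i : 'ker_N (coord i) <| N.
Proof. exact: normalGI (subsetT _) (ker_normal _). Qed.

Section Subdirect.

Variables (A : {group gT}) (N : {group {ffun I -> gT}}).
Hypothesis sdAN : subdirect A N.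

Lemma im_coord i : coord i @* N = A.
Proof. by case: (subdirectP A N) => [/(_ sdAN)]. Qed.

Lemma card_ker_coord i : (#|'ker_N (coord i)| * #|A|)%N = #|N|.
Proof.
by rewrite -(im_coord i) card_morphim setTI -indexgI Lagrange ?subsetIl.
Qed.

(* The [i]-th automorphism is [x i1 |-> x i]. *)
Lemma eq_ker_full_diagonal (i1 : I) :
    (forall i, 'ker_N (coord i) = 'ker_N (coord i1)) -> full_diagonal i1 A N.
Proof.
move=> eq_ker; pose f i := restrm_morphism (subsetT N) (coord_morphism i).
have im_f i : f i @* N = A by rewrite morphim_restrm setIid im_coord.
have eq_ker_f i : 'ker (f i) = 'ker (f i1) by rewrite !ker_restrm.
have sub_ker i : 'ker (f i1) \subset 'ker (f i) by rewrite eq_ker_f.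
pose h i := factm_morphism (sub_ker i) (subxx N).
have inj_h i : 'injm (h i) by apply/injm_factmP.
have im_h i : h i @* (f i1 @* N) = f i1 @* N by rewrite morphim_factm !im_f.
have autE x i : x \in N -> aut (inj_h i) (im_h i) (x i1) = x i.
  move=> Nx; rewrite autE ?(mem_morphim (f i1)) //=.
  exact: (factmE (sub_ker i) (subxx N) Nx).
rewrite -(im_f i1); exists (fun i => aut (inj_h i) (im_h i)).
split=> [i||]; first exact: Aut_aut.
  apply: (@eq_Aut _ (f i1 @* N)); rewrite ?Aut_aut ?group1 //.
  by move=> _ /morphimP[x _ Nx ->] /=; rewrite perm1 autE.
apply/setP=> x; apply/idP/imsetP=> [Nx | [_ /morphimP[y _ Ny ->] ->]].
  exists (x i1); first exact: (mem_morphim (f i1)).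
  by apply/ffunP=> i; rewrite ffunE autE.
by rewrite (_ : finfun _ = y) //; apply/ffunP=> i; rewrite ffunE autE.
Qed.

Lemma ker_coord_full_diagonal i1 i :
  full_diagonal i1 A N -> 'ker_N (coord i) = 1.
Proof.
case=> theta [Atheta _ defN]; apply/trivgP/subsetP=> x.
rewrite mem_ker_coord defN => /andP[/imsetP[a _ ->]].
have th1 j : theta j 1 = 1 by rewrite -(autmE (Atheta j)) morph1.
rewrite ffunE -[X in _ == X](th1 i) (inj_eq perm_inj) => /eqP->.
by apply/set1P/ffunP=> j; rewrite !ffunE th1.
Qed.

Lemma ker_coord_full_diagonal2 i j :
  full_diagonal2 A (rho i j @: N) -> 'ker_N (coord i) = 'ker_N (coord j).
Proof.
case=> theta Atheta defP; have th1 : theta 1 = 1.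
  by rewrite -(autmE Atheta) morph1.
apply/setP=> x; rewrite !mem_ker_coord; apply: andb_id2l => Nx.
have := imset_f (rho i j) Nx; rewrite defP => /imsetP[a _ [-> ->]].
by rewrite -{2}th1 (inj_eq perm_inj).
Qed.

Lemma im_coord_ker_neq1 i j : 'ker_N (coord i) != 'ker_N (coord j) ->
  coord j @* 'ker_N (coord i) != 1.
Proof.
apply: contra => /eqP im1.
rewrite eqEcard -(leq_pmul2r (cardG_gt0 A)) !card_ker_coord leqnn andbT.
by rewrite subsetI subsetIl ker_trivg_morphim subsetT im1 /=.
Qed.

(* Each kernel has a nontrivial normal image in every other coordinate, so one
   containing [T]; as [T] is perfect, the intersection of all the kernels but
   the [j]-th still maps onto [T] under the [j]-th coordinate. *)
Lemma power_perfect_sub (T : {group gT}) :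
    [~: T, T] = T -> T \subset A ->
    (forall H : {group gT}, H <| A -> H :!=: 1 -> T \subset H) ->
    (forall i j, i != j -> 'ker_N (coord i) != 'ker_N (coord j)) ->
  power T \subset N.
Proof.
move=> perfT sTA minT neq_ker.
have sT_ker i j : i != j -> T \subset coord j @* 'ker_N (coord i).
  move=> /neq_ker/im_coord_ker_neq1; apply: minT.
  by rewrite -(im_coord j) morphim_normal ?ker_coord_normal.
apply/subsetP=> x /powerP Tx.
have /fin_all_exists[y yP] j : exists y,
    [/\ y \in N, y j = x j & forall i, i != j -> y i = 1].
  have sTN : T \subset coord j @* N by rewrite im_coord.
  have := perfect_sub_morphim_bigcap perfT (subsetT N)
    (fun i _ => ker_coord_normal N i) sTN (fun i => sT_ker i j).
  move/subsetP/(_ _ (Tx j))/morphimP=> [y _ /setIP[Ny /bigcapP y1] xy].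
  by exists y; split=> // i /y1; rewrite mem_ker_coord => /andP[_ /eqP].
rewrite (_ : x = \prod_j y j).
  by apply: group_prod => j _; have [] := yP j.
apply/ffunP=> i; rewrite -[RHS]/(coord i _) morph_prod ?(big_only1 i) //.
  by have [_ <-] := yP i.
by move=> j neq_ji _; have [_ _ y1] := yP j; apply: y1; rewrite eq_sym.
Qed.

End Subdirect.

Lemma subdirect_subnormal_core (Y A : {group gT}) (N : {group {ffun I -> gT}}) :
    subdirect A N -> A <| Y -> A :!=: 1 ->
    (forall i j, i != j -> 'ker_N (coord i) != 'ker_N (coord j)) ->
  power (subnormal_core Y) \subset N \/
  exists K : {group gT},
    [/\ minimal_normal K Y,
        forall H : {group gT}, minimal_normal H Y -> H :=: K
      & exists2 p, prime p & K \isog Zp p].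
Proof.
move=> sdAN nsAY ntA neq_ker.
have ntY : Y :!=: 1 by apply: subG1_contra (normal_sub nsAY) ntA.
have [perfC | prC] := subnormal_core_perfect_or_prime ntY; [left | right].
  apply: (power_perfect_sub sdAN perfC) neq_ker => [|H nsHA ntH].
    exact: subnormal_core_min (normal_subnormal nsAY) ntA.
  apply: subnormal_core_min ntH.
  exact: subnormal_trans (normal_subnormal nsHA) (normal_subnormal nsAY).
have ntC : subnormal_core Y :!=: 1 by rewrite -cardG_gt1 prime_gt1.
exists (subnormal_core_group Y); split.
- exact: minimal_normal_subnormal_core.
- by move=> H; apply: minimal_normal_eq_subnormal_core.
exists #|subnormal_core Y| => //.
by rewrite isog_cyclic_card ?prime_cyclic //= ?card_Zp ?cardG_gt0.
Qed.

End DirectPower.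

Section WreathCoordinates.

Variables (Omega D : finType) (Sigma : {set {set Omega}}).
Variables (phi : Omega -> D * pts Sigma) (psi : D * pts Sigma -> Omega).
Hypotheses (phiK : cancel phi psi) (psiK : cancel psi phi).
Hypothesis partSigma : partition Sigma [set: Omega].
Hypothesis phi_block : forall o, o \in val (phi o).2.

Implicit Types (x z : {ffun pts Sigma -> {perm D}}) (s : {perm pts Sigma}).
Implicit Type g : {perm Omega}.

Lemma mem_block o (i : pts Sigma) : (o \in val i) = ((phi o).2 == i).
Proof.
have [_ tiSigma _] := and3P partSigma.
apply/idP/eqP=> [io | <- //]; apply: val_inj.
rewrite -(def_pblock tiSigma (valP i) io).
exact/esym/(def_pblock tiSigma (valP _) (phi_block o)).
Qed.

Definition wreath_perm x s : {perm Omega} :=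
  perm (inj_comp (can_inj psiK)
         (inj_comp (@perm_inj _ (base_perm x * top_perm D s)) (can_inj phiK))).

Lemma wreath_permE x s o :
  phi (wreath_perm x s o) = (x (phi o).2 (phi o).1, s (phi o).2).
Proof. by rewrite permE /= psiK permM !permE. Qed.

Lemma eq_wreath_perm x s g :
  (forall o, phi (g o) = (x (phi o).2 (phi o).1, s (phi o).2)) ->
  g = wreath_perm x s.
Proof.
by move=> gE; apply/permP=> o; apply: (can_inj phiK); rewrite gE wreath_permE.
Qed.

Lemma same_wreath_perm g x s :
  same_perm phi g (base_perm x * top_perm D s) = (g == wreath_perm x s).
Proof.
apply/forallP/eqP=> [gE | -> o]; last by rewrite wreath_permE permM !permE.
by apply: eq_wreath_perm => o; rewrite (eqP (gE o)) permM !permE.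
Qed.

Lemma transport_wreathP (A : {set {perm D}}) (L : {set {perm pts Sigma}}) g :
  reflect (exists2 x, x \in power _ A &
             exists2 s, s \in L & g = wreath_perm x s)
          (g \in transport phi (wreath A L)).
Proof.
rewrite inE; apply: (iffP exists_inP) => [[w] | [x Ax [s Ls ->]]].
  case/mulsgP=> _ _ /imsetP[x Ax ->] /imsetP[s Ls ->] ->.
  by rewrite same_wreath_perm => /eqP->; exists x; rewrite ?inE //; exists s.
exists (base_perm x * top_perm D s); last by rewrite same_wreath_perm.
by rewrite mem_mulg ?imset_f //; rewrite inE in Ax.
Qed.

Definition base_embedding x : {perm Omega} := wreath_perm x 1.

Fact base_embeddingM : {morph base_embedding : x y / x * y}.
Proof.
move=> x y; apply/esym/eq_wreath_perm => o.
by rewrite permM !wreath_permE /= !perm1 ffunE permM.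
Qed.

Canonical base_embedding_morphism :=
  @Morphism _ _ setT base_embedding (in2W base_embeddingM).

Lemma base_embeddingE x o :
  phi (base_embedding x o) = (x (phi o).2 (phi o).1, (phi o).2).
Proof. by rewrite wreath_permE perm1. Qed.

Lemma injm_base_embedding : 'injm base_embedding.
Proof.
apply/injmP=> x y _ _ eq_xy; apply/ffunP=> i; apply/permP=> d.
have := congr1 (fun g : {perm Omega} => phi (g (psi (d, i)))) eq_xy.
by rewrite /= !base_embeddingE psiK => -[].
Qed.

Lemma same_base_perm g x :
  same_perm phi g (base_perm x) = (g == base_embedding x).
Proof.
rewrite -same_wreath_perm; congr (same_perm _ _ _).
suff ->: top_perm D (1 : {perm pts Sigma}) = 1 by rewrite mulg1.
by apply/permP=> -[d i]; rewrite permE /top_fun /= !perm1.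
Qed.

Definition coordinates (N : {set {perm Omega}}) := base_embedding @*^-1 N.

Canonical coordinates_group (N : {group {perm Omega}}) :=
  Eval hnf in [group of coordinates N].

Lemma mem_coordinates N x : (x \in coordinates N) = (base_embedding x \in N).
Proof. by rewrite !inE. Qed.

Lemma tuplesE N : tuples phi N = coordinates N.
Proof.
apply/setP=> x; rewrite mem_coordinates inE.
apply/exists_inP/idP=> [[g Ng] | Nx].
  by rewrite same_base_perm => /eqP <-.
by exists (base_embedding x); rewrite // same_base_perm.
Qed.

Lemma transport_baseE (A : {set {perm D}}) :
  transport phi (base_group _ A) = base_embedding @* power _ A.
Proof.
apply/setP=> g; rewrite inE morphimEsub ?subsetT //.
apply/exists_inP/imsetP=> [[_ /imsetP[x Ax ->]] | [x Ax ->]].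
  by rewrite same_base_perm => /eqP->; exists x; rewrite ?inE.
exists (base_perm x); last by rewrite same_base_perm.
by rewrite inE in Ax; rewrite imset_f.
Qed.

Lemma base_embedding_astab x i :
  (base_embedding x \in 'C(val i | 'P)) = (x i == 1).
Proof.
apply/astabP/eqP=> [fix_i | xi1 o].
  apply/permP=> d; have := fix_i (psi (d, i)).
  rewrite mem_block psiK eqxx => /(_ isT)/(congr1 phi).
  by rewrite /= /aperm base_embeddingE psiK perm1 => -[].
rewrite mem_block /= => /eqP oi; apply: (can_inj phiK).
by rewrite /aperm base_embeddingE oi xi1 perm1 -oi -surjective_pairing.
Qed.

Lemma im_base_embedding : base_embedding @* setT = 'C(Sigma | 'P^*).
Proof.
apply/setP=> g; rewrite morphimEdom.
apply/imsetP/astabP=> [[x _ ->] B SB | fixSigma].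
  pose i : pts Sigma := exist _ B SB.
  apply/eqP; rewrite eqEcard card_setact leqnn andbT.
  apply/subsetP=> _ /imsetP[o + ->]; rewrite -![B]/(val i) !mem_block.
  by rewrite /= /aperm base_embeddingE.
have phi2 o : (phi (g o)).2 = (phi o).2.
  apply/eqP; rewrite -mem_block -(fixSigma _ (valP (phi o).2)).
  by apply: (mem_setact 'P); rewrite mem_block.
have x_inj i : injective (fun d => (phi (g (psi (d, i)))).1).
  move=> d e eq_de; suff: psi (d, i) = psi (e, i) by move/(can_inj psiK) => [].
  apply/(@perm_inj _ g)/(can_inj phiK).
  by rewrite [LHS]surjective_pairing [RHS]surjective_pairing eq_de !phi2 !psiK.
exists [ffun i => perm (@x_inj i)] => //; apply: eq_wreath_perm => o.
rewrite ffunE permE perm1 -surjective_pairing phiK -(phi2 o).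
exact: surjective_pairing.
Qed.

Lemma base_embeddingJ z x s :
  base_embedding z ^ wreath_perm x s =
    base_embedding [ffun i => z (s^-1 i) ^ x (s^-1 i)].
Proof.
apply: eq_wreath_perm => o; rewrite -[o](permKV (wreath_perm x s)) permJ.
by rewrite !wreath_permE /= !perm1 ffunE permK permJ.
Qed.

Lemma coordinatesK (N : {group {perm Omega}}) :
  N \subset 'C(Sigma | 'P^*) -> base_embedding @* coordinates N = N.
Proof. by rewrite -im_base_embedding => /morphpreK. Qed.

Lemma coordinatesP (N : {group {perm Omega}}) g : N \subset 'C(Sigma | 'P^*) ->
  reflect (exists2 x, x \in coordinates N & g = base_embedding x) (g \in N).
Proof.
move=> sNC; rewrite -{2}(coordinatesK sNC) morphimEsub ?subsetT //.
exact: imsetP.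
Qed.

Lemma coordinates_inj (N1 N2 : {group {perm Omega}}) :
    N1 \subset 'C(Sigma | 'P^*) -> N2 \subset 'C(Sigma | 'P^*) ->
  coordinates N1 = coordinates N2 -> N1 :=: N2.
Proof.
by move=> sN1C sN2C eqN; rewrite -(coordinatesK sN1C) eqN coordinatesK.
Qed.

Lemma coord_base_conj (N : {group {perm Omega}}) x s i :
    N \subset 'C(Sigma | 'P^*) -> wreath_perm x s \in 'N(N) ->
  coord (s i) @* coordinates N = (coord i @* coordinates N) :^ x i.
Proof.
move=> sNC nNg; apply/setP=> a.
apply/morphimP/imsetP=> [[y _ Ny ->] | [_ /morphimP[z _ Nz ->] ->]].
  have Nyg : base_embedding y ^ (wreath_perm x s)^-1 \in N.
    by rewrite memJ_norm ?groupV // -mem_coordinates.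
  have [z Nz def_z] := coordinatesP _ sNC Nyg.
  exists (z i); first exact: mem_im_coord.
  have ->: y = [ffun j => z (s^-1 j) ^ x (s^-1 j)].
    apply: (injmP injm_base_embedding); rewrite ?inE //= -base_embeddingJ.
    exact: canRL (conjgKV _) def_z.
  by rewrite /= /coord ffunE permK.
exists [ffun j => z (s^-1 j) ^ x (s^-1 j)]; first exact: in_setT.
  by rewrite mem_coordinates -base_embeddingJ memJ_norm // -mem_coordinates.
by rewrite /= /coord ffunE permK.
Qed.

Lemma ker_coord_coordinates N i :
  'ker_(coordinates N) (coord i) = coordinates 'C_N(val i | 'P).
Proof.
apply/setP=> x; rewrite !mem_coordinates [RHS]inE base_embedding_astab.
by rewrite !inE.
Qed.

Lemma transport_base_isog_Fp p (A : {group {perm D}}) : prime p -> #|A| = p ->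
  transport phi (base_group _ A) \isog [set: 'rV['F_p]_#|Sigma|].
Proof.
move=> p_pr oA; rewrite transport_baseE.
rewrite -(isog_transl _ (sub_isog (subsetT _) injm_base_embedding)).
have <-: #|{: pts Sigma}| = #|Sigma| by rewrite card_sig; apply: eq_card.
exact: power_isog_Fp.
Qed.

End WreathCoordinates.

Section ImprimitiveClosure.

Variables (Omega : finType) (G : {group {perm Omega}}).
Variables (Sigma : {set {set Omega}}) (Delta1 : pts Sigma).
Variable phi : Omega -> pts (val Delta1) * pts Sigma.
Variable psi : pts (val Delta1) * pts Sigma -> Omega.

Local Notation Delta := (val Delta1).
Local Notation M := 'N_G(Delta | 'P)%G.
Local Notation R := (induced_group 'P Delta M).
Local Notation X := (closure2_group G).
Local Notation Y := (induced_group 'P Delta 'N_X(Delta | 'P)%G).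
Local Notation K := 'C_X(Sigma | 'P^*)%G.
Local Notation A := (induced_group 'P Delta K).

Hypothesis trG : [transitive G, on [set: Omega] | 'P].
Hypothesis partSigma : partition Sigma [set: Omega].
Hypothesis actsG : [acts G, on Sigma | 'P^*].
Hypotheses (phiK : cancel phi psi) (psiK : cancel psi phi).
Hypothesis phi_block : forall o, o \in val (phi o).2.
Hypothesis phi_fst : forall d : pts Delta, (phi (val d)).1 = d.
Hypothesis sGW : G \subset transport phi (wreath R (induced 'P^* Sigma G)).

Local Notation emb := (base_embedding phiK psiK).
Local Notation T := (coordinates_group phiK psiK K).

Let in_block o (i : pts Sigma) : (o \in val i) = ((phi o).2 == i).
Proof. exact: mem_block. Qed.

Let phi_val (d : pts Delta) : phi (val d) = (d, Delta1).
Proof.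
rewrite [phi _]surjective_pairing phi_fst; congr (_, _).
by apply/eqP; rewrite -in_block (valP d).
Qed.

Let sKC : K \subset 'C(Sigma | 'P^*).
Proof. exact: subsetIr. Qed.

Let sCKC B : 'C_K(B | 'P) \subset 'C(Sigma | 'P^*).
Proof. exact: subset_trans (subsetIl _ _) sKC. Qed.

Lemma restrict_base_embedding x :
  restrict 'P Delta (emb x) = x Delta1.
Proof.
have nDx : emb x \in 'N(Delta | 'P).
  by apply/astabsP=> o; rewrite !in_block /= /aperm base_embeddingE.
apply/permP=> d; apply: val_inj; rewrite val_restrict //; apply: (can_inj phiK).
by rewrite /= /aperm base_embeddingE !phi_val.
Qed.

Lemma wreath_perm_to_block i : exists x, exists s,
  [/\ wreath_perm phiK psiK x s \in G, x Delta1 \in R & s Delta1 = i].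
Proof.
have [o oD] := block_nonempty partSigma (valP Delta1).
have [o' o'i] := block_nonempty partSigma (valP i).
have [g Gg def_o'] := atransP2 trG (in_setT o) (in_setT o').
have /(transport_wreathP phiK psiK) := subsetP sGW g Gg.
case=> x /powerP Rx [s _ def_g]; exists x, s; rewrite -def_g; split=> //.
move: oD o'i; rewrite !in_block => /eqP oD /eqP <-.
by rewrite def_o' def_g /= /aperm wreath_permE /= oD.
Qed.

Lemma sub_induced_closure2 : R \subset Y.
Proof. by rewrite morphimS // setSI ?sub_closure2. Qed.

Lemma closure2_ker_normal : K <| X.
Proof.
rewrite /normal subsetIl normsI ?normG //.
exact: subset_trans (closure2_acts_blocks partSigma actsG) (astab_norm _ _).
Qed.

Lemma closure2_ker_norm : G \subset 'N(K).
Proof.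
exact: subset_trans (sub_closure2 G) (normal_norm closure2_ker_normal).
Qed.

Lemma closure2_ker_sub_stab : K \subset 'N_X(Delta | 'P).
Proof. by rewrite setIS // -astab1_set astabS // sub1set (valP Delta1). Qed.

Lemma induced_ker_normal : A <| Y.
Proof.
rewrite /= !inducedE morphim_normal //.
exact: normalS closure2_ker_sub_stab (subsetIl _ _) closure2_ker_normal.
Qed.

Lemma im_coord_closure2_ker : coord Delta1 @* T = A.
Proof.
have sKD : K \subset 'N(Delta | 'P).
  by rewrite (subset_trans closure2_ker_sub_stab) ?subsetIr.
rewrite /= inducedE; apply/setP=> a.
apply/morphimP/morphimP=> [[y _ Ty ->] | [k _ Kk ->]].
  rewrite mem_coordinates in Ty; exists (emb y) => //.
    exact: (subsetP sKD).
  exact/esym/restrict_base_embedding.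
have [y Ty def_k] := coordinatesP phiK psiK partSigma phi_block _ sKC Kk.
by exists y; rewrite ?in_setT // def_k; apply: restrict_base_embedding.
Qed.

Lemma subdirect_coordinates : subdirect A T.
Proof.
apply/subdirectP=> i; have [x [s [Gxs Rx <-]]] := wreath_perm_to_block i.
have nKxs := subsetP closure2_ker_norm _ Gxs.
rewrite (coord_base_conj partSigma phi_block _ sKC nKxs) im_coord_closure2_ker.
apply: (normsP (normal_norm induced_ker_normal)).
exact: (subsetP sub_induced_closure2).
Qed.

Lemma closure2_base_group : X :&: transport phi (base_group _ Y) = K.
Proof.
rewrite (transport_baseE phiK psiK); apply/setP=> g.
apply/setIP/idP=> [[Xg /morphimP[x _ _ def_g]] | Kg].
  rewrite in_setI Xg /= -(im_base_embedding phiK psiK partSigma phi_block).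
  by rewrite def_g mem_morphim ?inE.
split; first by case/setIP: Kg.
have [x Tx ->] := coordinatesP phiK psiK partSigma phi_block _ sKC Kg.
rewrite mem_morphim ?inE //; apply/ffun_onP=> i.
rewrite (subsetP (normal_sub induced_ker_normal)) //.
by rewrite -(im_coord subdirect_coordinates i) mem_im_coord.
Qed.

Lemma induced_ker_neq1 : K :!=: 1 -> A :!=: 1.
Proof.
apply: contra => /eqP A1.
rewrite -(coordinatesK phiK psiK partSigma phi_block sKC).
rewrite morphim_injm_eq1 ?injm_base_embedding ?subsetT //.
apply/eqP/trivgP/subsetP=> x Tx; apply/set1P/ffunP=> i; rewrite ffunE.
apply/set1P; rewrite -[[set 1]]A1 -(im_coord subdirect_coordinates i).
exact: mem_im_coord.
Qed.

Lemma ker_coord_eq_or_distinct : maximal M G ->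
  (forall i, 'ker_T (coord i) = 'ker_T (coord Delta1)) \/
  (forall i j, i != j -> 'ker_T (coord i) != 'ker_T (coord j)).
Proof.
move=> maxM; have trSigma := atrans_blocks partSigma actsG trG.
have primG : [primitive G, on Sigma | 'P^*].
  rewrite (trans_prim_astab (valP Delta1)) // astab1_set.
  by rewrite /maximal_eq maxM orbT.
have equivC : {in Sigma & G, forall B g,
    'C_K('P^*%act B g | 'P) = 'Js%act 'C_K(B | 'P) g}.
  move=> B g _ Gg; rewrite /= astab_setact [RHS]conjIg; congr (_ :&: _).
  exact/esym/(normsP closure2_ker_norm).
have kerE i : 'ker_T (coord i) = coordinates phiK psiK 'C_K(val i | 'P).
  exact: ker_coord_coordinates.
have [eqC | injC] := prim_equivariant_const_or_inj primG equivC.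
  left=> i; rewrite !kerE; congr (coordinates phiK psiK _).
  exact: eqC (valP i) (valP Delta1).
right=> i j; apply: contra_neq; rewrite !kerE => eq_ker.
apply/val_inj/(injC _ _ (valP i) (valP j)).
exact: (coordinates_inj partSigma phi_block (sCKC _) (sCKC _) eq_ker).
Qed.

Lemma full_diagonal_or_subnormal_core : K :!=: 1 -> maximal M G ->
  full_diagonal Delta1 A T \/
  (forall i j, i != j -> ~ full_diagonal2 A (rho i j @: T)) /\
  (transport phi (base_group _ (subnormal_core Y)) \subset K \/
   exists H : {group {perm pts Delta}},
     [/\ minimal_normal H Y,
         forall H' : {group {perm pts Delta}}, minimal_normal H' Y -> H' :=: H
       & exists2 p, prime p & H \isog Zp p]).
Proof.
move=> ntK maxM; have sdAT := subdirect_coordinates.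
have [eq_ker | neq_ker] := ker_coord_eq_or_distinct maxM.
  by left; apply: eq_ker_full_diagonal.
right; split=> [i j neq_ij diag_ij|].
  by case/eqP: (neq_ker i j neq_ij); apply: ker_coord_full_diagonal2 diag_ij.
have nsAY := induced_ker_normal; have ntA := induced_ker_neq1 ntK.
have [sCT | ?] := subdirect_subnormal_core sdAT nsAY ntA neq_ker;
  last by right.
by left; rewrite (transport_baseE phiK psiK) sub_morphim_pre ?subsetT.
Qed.

Lemma abelian_induced_closure2 : abelian R -> Y :=: R.
Proof.
move=> cRR; apply/eqP; rewrite eqEsubset sub_induced_closure2 andbT.
have trR : [transitive R, on [set: pts Delta] | 'P].
  apply: induced_transitive.
  exact: (atrans_astabs_block partSigma actsG trG (valP Delta1)).
rewrite -(closure2_abelian_transitive cRR trR).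
exact: (induced_block_closure2 partSigma actsG (valP Delta1)).
Qed.

Lemma cent_stab_full_diagonal : abelian Y -> full_diagonal Delta1 A T ->
  M \subset 'C(K).
Proof.
move=> cYY diagT; set H := 'N_X(Delta | 'P)%G in cYY.
have sMH : M \subset H by rewrite setSI ?sub_closure2.
have sKH : K \subset H := closure2_ker_sub_stab.
have CK1 : 'C_K(Delta | 'P) = 1.
  rewrite -[LHS](coordinatesK phiK psiK partSigma phi_block (sCKC _)).
  rewrite -(ker_coord_coordinates _ _ partSigma phi_block).
  by rewrite (ker_coord_full_diagonal _ diagT) morphim1.
apply/commG1P/trivgP; rewrite -CK1 subsetI.
rewrite commg_subr (subset_trans (subsetIl _ _) closure2_ker_norm).
apply: subset_trans (commgSS sMH sKH) (der1_sub_astab _ cYY).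
exact: subsetIr.
Qed.

Lemma straight_full_diagonal : maximal M G -> ~~ (M <| G) -> abelian Y ->
    full_diagonal Delta1 A T ->
  T :=: straight_diagonal (pts Sigma) _ A.
Proof.
move=> maxM not_nsMG cYY diagT; have nKG := closure2_ker_norm.
have cKG : 'C_G(K) = G.
  apply: (normal_sup_nonnormal_maximal maxM not_nsMG (H := 'C_G(K)%G)).
    by rewrite subsetI subsetIl cent_stab_full_diagonal.
  by rewrite /normal subsetIl normsI ?normG ?norms_cent.
apply: (straight_diagonal_const im_coord_closure2_ker) => z i Tz.
have [x [s [Gxs Rx <-]]] := wreath_perm_to_block i.
have zJ : z = [ffun j => z (s^-1 j) ^ x (s^-1 j)].
  apply: (injmP (injm_base_embedding phiK psiK)); rewrite ?in_setT //=.
  rewrite -base_embeddingJ; apply/esym/conjg_fixP/commgP.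
  move: Gxs; rewrite -cKG => /setIP[_ /centP cKxs].
  by apply/commute_sym/cKxs; rewrite -mem_coordinates.
rewrite {1}zJ ffunE permK; apply/conjg_fixP/commgP/(centsP cYY).
  rewrite (subsetP (normal_sub induced_ker_normal)) // -im_coord_closure2_ker.
  exact: mem_im_coord.
exact: (subsetP sub_induced_closure2).
Qed.

Lemma prime_induced_closure2 p : prime p -> #|R| = p -> K :!=: 1 ->
  Y :=: R /\ A :=: R.
Proof.
move=> p_pr oR ntK; have cRR : abelian R.
  by rewrite cyclic_abelian ?prime_cyclic ?oR.
have YR := abelian_induced_closure2 cRR; split=> //.
have sAR : A \subset R by rewrite -YR (normal_sub induced_ker_normal).
apply/eqP; rewrite eqEsubset sAR.
apply: contraR (induced_ker_neq1 ntK) => not_sRA.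
by rewrite -(setIidPl sAR) setIC prime_TIg ?oR.
Qed.

Lemma prime_full_diagonal p :
    K :!=: 1 -> maximal M G -> ~~ (M <| G) -> prime p -> #|R| = p ->
    full_diagonal Delta1 A T ->
  [/\ Y :=: R, T :=: straight_diagonal (pts Sigma) _ R
    & transport phi (base_group _ R) \isog [set: 'rV['F_p]_#|Sigma|]].
Proof.
move=> ntK maxM not_nsMG p_pr oR diagT.
have [YR AR] := prime_induced_closure2 p_pr oR ntK.
split=> //; last exact: (transport_base_isog_Fp phiK psiK).
rewrite -AR; apply: straight_full_diagonal => //.
by rewrite YR cyclic_abelian ?prime_cyclic ?oR.
Qed.

End ImprimitiveClosure.

Theorem proposition3p8 (Omega : finType) (G : {group {perm Omega}})
    (Sigma : {set {set Omega}}) (Delta1 : pts Sigma)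
    (phi : Omega -> pts (val Delta1) * pts Sigma) :
  let Delta := val Delta1 in
  let L := induced 'P^* Sigma G in
  let M := 'N_G(Delta | 'P) in
  let R := induced 'P Delta M in
  (* the setting *)
  [transitive G, on [set: Omega] | 'P] ->
  partition Sigma [set: Omega] ->
  [acts G, on Sigma | 'P^*] ->
  1 < #|Sigma| < #|Omega| ->
  gcore M G = 1 ->
  (* phi identifies Omega with Delta * Sigma, so that G <= R wr L *)
  bijective phi ->
  (forall o, o \in val (phi o).2) ->
  (forall d : pts Delta, (phi (val d)).1 = d) ->
  G \subset transport phi (wreath R L) ->
  let X := closure2 G in
  let Y := induced 'P Delta 'N_X(Delta | 'P) in
  let N := X :&: transport phi (base_group _ Y) in
  G :!=: X ->
  L = closure2 L ->
  (* (a) *)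
  N ><| G = X /\ N :!=: 1 /\
  exists A : {group {perm pts Delta}},
    [/\ A <| Y /\ subdirect A (tuples phi N),
  (* (b) *)
        maximal M G ->
          full_diagonal Delta1 A (tuples phi N)
          \/ (forall i j : pts Sigma, i != j ->
                ~ full_diagonal2 A (rho i j @: tuples phi N))
             /\ (transport phi (base_group _ (subnormal_core Y)) \subset N
                 \/ exists K : {group {perm pts Delta}},
                      [/\ minimal_normal K Y,
                          forall H : {group {perm pts Delta}},
                            minimal_normal H Y -> H :=: K
                        & exists2 p, prime p & K \isog Zp p])
  (* (c) *)
      & forall p, maximal M G -> ~~ (M <| G) -> prime p -> #|R| = p ->
          full_diagonal Delta1 A (tuples phi N) ->
          [/\ Y = R,
              tuples phi N = straight_diagonal (pts Sigma) _ R
            & transport phi (base_group _ R)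
                \isog [set: 'rV['F_p]_#|Sigma|]]].
Proof.
move=> Delta L M R trG partS actsG _ coreM [psi phiK psiK] phi_block phi_fst.
move=> sGW X Y N neqGX closedL.
have sdX : 'C_X(Sigma | 'P^*) ><| G = X.
  exact: (closure2_sdprod partS actsG (valP Delta1)).
have ntK : 'C_X(Sigma | 'P^*) != 1.
  by apply: contraNneq neqGX => K1; rewrite -sdX K1 sdprod1g.
have -> : N = 'C_X(Sigma | 'P^*).
  exact: (closure2_base_group trG _ _ phiK psiK).
split=> //; split=> //; exists (induced_group 'P Delta 'C_X(Sigma | 'P^*)%G).
rewrite (tuplesE phiK psiK); split.
- by split; [apply: induced_ker_normal | apply: subdirect_coordinates].
- exact: (full_diagonal_or_subnormal_core trG).
- by move=> p; apply: (prime_full_diagonal trG).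
Qed.
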